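(* Assume that $X[\mathcal{T}]$ is a locally convex topological vector space; $\mathcal{C}$ is a non-decreasing countable localizing family in $X$; each member of $\mathcal{C}$ is $\mathcal{T}$-closed; and a subset of $X$ is $\mathcal{T}_{\mathcal{C}}$-bounded if and only if it is contained in some $C\in\mathcal{C}$. Then $X[\mathcal{T}_{\mathcal{C}}]^*[\beta(X^*,X)]$ is a Fréchet space.
   Context: All vector spaces are real; topological vector spaces are Hausdorff. $X[\mathcal{T}]$ denotes $X$ equipped with the topology $\mathcal{T}$; $\mathcal{T}|_C=\{E\cap C:E\in\mathcal{T}\}$. A localizing family in a vector space $X$ is a non-empty collection $\mathcal{C}$ of convex subsets of $X$ containing $0$ such that for all $C\in\mathcal{C}$, $x\in X$, $t\in\mathbb{R}$ there is $D\in\mathcal{C}$ with $x+t\cdot C\subseteq D$. It is non-decreasing countable if it can be numbered $\mathcal{C}=\{C_k:k\in\mathbb{N}\}$ with $C_k\subseteq C_{k+1}$ for all $k$. The localization $\mathcal{T}_{\mathcal{C}}$ is the locally convex vector topology on $X$ consisting of all $E\subseteq X$ such that for every $x\in E$ there is a convex $V$ with $x\in V\subseteq E$ and $V\cap C\in\mathcal{T}|_C$ for every $C\in\mathcal{C}$. $X[\mathcal{T}_{\mathcal{C}}]^*$ is the space of $\mathcal{T}_{\mathcal{C}}$-continuous linear forms on $X$; $\beta(X^*,X)$ is its strong topology (uniform convergence on $\mathcal{T}_{\mathcal{C}}$-bounded subsets of $X$). A Fréchet space is a metrizable complete locally convex space. *)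

(* Defs.v *)
From HB Require Import structures.
From mathcomp Require Import all_boot all_order all_algebra.
From mathcomp Require Import all_classical all_reals all_analysis.

Set Implicit Arguments.
Unset Strict Implicit.
Unset Printing Implicit Defensive.

Import Order.TTheory GRing.Theory Num.Theory.
Import numFieldNormedType.Exports.

Local Open Scope classical_set_scope.
Local Open Scope ring_scope.

Section localization.
Context {R : realType} {X : preTopologicalLmodType R}.

Definition localizing_family (CC : set (set X)) : Prop :=
  [/\ CC !=set0,
      forall C, CC C -> convex_set C /\ C 0 &
      forall C (x : X) (t : R), CC C ->
        exists2 D, CC D & [set x + t *: c | c in C] `<=` D].

Definition nondecreasing_countable (CC : set (set X)) : Prop :=
  exists2 c : nat -> set X, CC = range c & forall k, c k `<=` c k.+1.

Definition trace_topology (C : set X) : set_system X :=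
  [set E `&` C | E in open].

(* An alias of [X], to carry the localized topology beside that of [X]. *)
Definition localization (CC : set (set X)) : Type := X.

Section topology.
Variable CC : set (set X).

HB.instance Definition _ := GRing.Lmodule.on (localization CC).

Definition localized_open : set_system (localization CC) :=
  [set E : set X | forall x, E x -> exists V : set X,
    [/\ convex_set V, V x, V `<=` E &
        forall C, CC C -> trace_topology C (V `&` C)]].

Let localized_openT : localized_open setT.
Proof.
move=> x _; exists setT; split=> // C _.
by exists setT => //; exact: openT.
Qed.

Let localized_openI : setI_closed localized_open.
Proof.
move=> A B oA oB x [/oA[V [cV Vx VA tV]] /oB[W [cW Wx WB tW]]].
exists (V `&` W); split=> //.
- move=> y z l; rewrite !inE => -[Vy Wy] [Vz Wz].
  by split; apply/set_mem; [apply: cV|apply: cW]; rewrite inE.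
- exact: setISS.
- move=> C CCC; have [E oE EV] := tV _ CCC; have [F oF FW] := tW _ CCC.
  by exists (E `&` F); [exact: openI|rewrite setIIl EV FW -setIIl].
Qed.

Let localized_open_bigU (I : Type) (f : I -> set (localization CC)) :
  (forall i, localized_open (f i)) -> localized_open (\bigcup_i f i).
Proof.
move=> of_ x [i _ /of_[V [cV Vx Vf tV]]].
by exists V; split=> // y /Vf; exists i.
Qed.

HB.instance Definition _ := isOpenTopological.Build (localization CC)
  localized_openT localized_openI localized_open_bigU.

End topology.

End localization.

Definition tvs_bounded {R : realType} {E : preTopologicalLmodType R}
    (B : set E) : Prop :=
  forall U : set E, nbhs 0 U ->
    exists2 r : R, 0 < r &
      forall t : R, r <= `|t| -> B `<=` [set t *: u | u in U].

Section dual.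
Context {R : realType}.
Variable E : preTopologicalLmodType R.

Definition continuous_linear_form : {pred E -> R^o} :=
  fun f => `[< linear f /\ continuous f >].

Let continuous_linear_form_closed : submod_closed continuous_linear_form.
Proof.
split.
  apply/asboolP; split=> [a x y|]; first by rewrite scaler0 addr0.
  exact: cst_continuous.
move=> a f g /asboolP[lf cf] /asboolP[lg cg]; apply/asboolP; split.
  move=> b x y; rewrite !fctE /= lf lg !scalerDr !scalerA (mulrC a b) !addrA.
  by congr (_ + _); rewrite -!addrA; congr (_ + _); rewrite addrC.
move=> x; apply: cvgD; last exact: cg.
by apply: cvgZr; exact: cf.
Qed.

HB.instance Definition _ := GRing.isSubmodClosed.Build R (E -> R^o)
  continuous_linear_form continuous_linear_form_closed.

Record continuous_dual := ContinuousDual {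
  dual_fun :> E -> R^o ;
  dual_funP : dual_fun \in continuous_linear_form }.

HB.instance Definition _ := [isSub for dual_fun].
HB.instance Definition _ := [Choice of continuous_dual by <:].
HB.instance Definition _ := [SubChoice_isSubLmodule of continuous_dual by <:].

(* Uniform convergence on the bounded subsets of [E]. *)
Definition strong_dual : Type := continuous_dual.

HB.instance Definition _ := GRing.Lmodule.on strong_dual.
HB.instance Definition _ := Uniform.copy strong_dual
  (initial_topology
    (dual_fun : continuous_dual -> {family @tvs_bounded R E, E -> R^o})).

End dual.
Arguments dual_fun {R E} _ _.

Section frechet.
Context {R : realType}.

(* These are the axioms of [tvsType]; Hausdorffness of a Frechet space follows
   from metrizability. *)
Definition locally_convex_tvs (E : preTopologicalLmodType R) : Prop :=
  [/\ continuous (fun z : E * E => z.1 + z.2),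
      continuous (fun z : R^o * E => z.1 *: z.2) &
      exists2 B : set_system E,
        (forall b, b \in B -> convex_set b) & basis B].

Definition metrizable (T : topologicalType) : Prop :=
  exists (M : metricType R) (f : T -> M) (g : M -> T),
    [/\ cancel f g, cancel g f, continuous f & continuous g].

(* Completeness of a topological vector space refers to the translation-invariant
   uniformity, which is determined by the topology; the uniformity carried by a
   [tvsType] is not required to be that one, so it is not used here. *)
Definition tvs_cauchy (E : preTopologicalLmodType R) (F : set_system E) : Prop :=
  forall U : set E, nbhs 0 U ->
    exists2 A, F A & forall x y, A x -> A y -> U (x - y).

Definition tvs_complete (E : preTopologicalLmodType R) : Prop :=
  forall F : set_system E, ProperFilter F -> tvs_cauchy F ->
    exists l : E, F --> l.

Definition frechet_space (E : preTopologicalLmodType R) : Prop :=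
  [/\ locally_convex_tvs E, metrizable E & tvs_complete E].

End frechet.

(* Main.v *)
(* Every bounded set lies in one of the countably many members [c k], so the
   seminorms sup_{c k} |f| define the strong topology, and
   sup_{k, x in c k} min(|f x - g x|, 1/(k+1)) is a metric for it. A Cauchy filter
   converges pointwise, hence uniformly on every [C] in [CC], to a linear form [l].
   Forms continuous for the localization restrict to continuous functions on [C]
   for the topology of [X], so [l] restricted to [C] is continuous too. As the preimage
   under [l] of an interval is convex, it is itself the convex set required by
   the definition of the localized topology. *)
Require Import Defs.
From HB Require Import structures.
From mathcomp Require Import all_boot all_order all_algebra.
From mathcomp Require Import all_classical all_reals all_analysis.
From mathcomp Require Import lra.

Set Implicit Arguments.
Unset Strict Implicit.
Unset Printing Implicit Defensive.

Import Order.TTheory GRing.Theory Num.Theory.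
Import numFieldNormedType.Exports.

Local Open Scope classical_set_scope.
Local Open Scope ring_scope.

(** Balls of the strong dual and preimages of balls under linear forms inherit their convexity from
    this bound. *)
Lemma ler_norm_conv {R : realDomainType} (t a b m : R) : 0 <= t -> t <= 1 ->
  `|a| <= m -> `|b| <= m -> `|t * a + (1 - t) * b| <= m.
Proof.
move=> t0; rewrite -subr_ge0 => t1 am bm.
rewrite (le_trans (ler_normD _ _))// !normrM (ger0_norm t0) (ger0_norm t1).
rewrite [leRHS](_ : m = t * m + (1 - t) * m); last by lra.
by rewrite lerD// ler_wpM2l.
Qed.

Section bounded.
Context {R : realType} {E : preTopologicalLmodType R}.

Lemma tvs_bounded_set0 : tvs_bounded (set0 : set E).
Proof. by move=> U _; exists 1 => // t _ x []. Qed.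

Lemma tvs_boundedU (A B : set E) :
  tvs_bounded A -> tvs_bounded B -> tvs_bounded (A `|` B).
Proof.
move=> bA bB U U0; have [r r0 rA] := bA _ U0; have [s s0 sB] := bB _ U0.
exists (Num.max r s) => [|t]; first by rewrite lt_max r0.
by rewrite ge_max => /andP[rt st] x [/(rA _ rt)|/(sB _ st)].
Qed.

End bounded.

(** * Neighbourhoods, vector operations and local convexity in the strong dual *)

Section strong_dual_topology.
Context {R : realType} {E : preTopologicalLmodType R}.
Implicit Types (f g : strong_dual E) (B : set E).

Lemma dual_linear f (a : R) (x y : E) : f (a *: x + y) = a * f x + f y.
Proof. by have /asboolP[lf _] := dual_funP f; rewrite lf. Qed.

Lemma dual0 f : f 0 = 0.
Proof. by have := dual_linear f (-1) 0 0; rewrite scaler0 addr0 mulN1r addNr. Qed.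

Lemma dualZ f (a : R) (x : E) : f (a *: x) = a * f x.
Proof. by rewrite -[a *: x]addr0 dual_linear dual0 addr0. Qed.

(** The preimage of the unit ball under [f] is a neighbourhood of 0, so some multiple of it by [r]
    contains [B], and [r] bounds [f] there. *)
Lemma dual_bounded f B : tvs_bounded B ->
  exists2 M, 0 < M & forall x, B x -> `|f x| < M.
Proof.
have /asboolP[_ cf] := dual_funP f => bB.
have /bB[r r0 rB] : nbhs 0 (f @^-1` ball (0 : R^o) 1).
  by apply: cf; rewrite dual0; exact: nbhsx_ballx.
exists r => // x /(rB r); rewrite gtr0_norm// => /(_ (lexx r))[u fu <-].
rewrite dualZ normrM gtr0_norm// -[ltRHS]mulr1 ltr_pM2l//.
by move: fu; rewrite /= -ball_normE /= sub0r normrN.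
Qed.

Definition dual_ball f B (e : R) : set (strong_dual E) :=
  [set g | forall x, B x -> `|f x - g x| < e].

(** From left to right: the balls around [f] generate a filter that converges to [f] uniformly on
    every bounded set, so each open set around [f] contains one of them. A single [B] suffices
    because bounded sets are stable under union. *)
Lemma strong_dual_nbhsP f (A : set (strong_dual E)) :
  nbhs f A <-> exists2 B, tvs_bounded B & exists2 e, 0 < e & dual_ball f B e `<=` A.
Proof.
split=> [|[B bB [e e0 sA]]]; last first.
  apply: filterS sA _.
  have := @initial_continuous _ _ (dual_fun : continuous_dual E ->
    {family @tvs_bounded R E, E -> R^o}) f.
  apply; apply: (fam_nbhs (E := [set p | ball p.1 e p.2])) => //.
  exact: (entourage_ball R^o (PosNum e0)).
rewrite nbhsE => -[_ [[W oW <-] Wf] sA].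
pose D (p : set E * R) := tvs_bounded p.1 /\ 0 < p.2.
pose N (p : set E * R) := [set h : E -> R^o | forall x, p.1 x -> `|f x - h x| < p.2].
have FF : Filter (filter_from D N).
  apply: filter_from_filter; first exists (set0, 1) => //.
    by split=> //; exact: tvs_bounded_set0.
  move=> [B e] [C d] [/= bB e0] [/= bC d0].
  exists (B `|` C, Num.min e d) => /=.
    by split; [exact: tvs_boundedU|rewrite lt_min e0].
  move=> h hBC; split=> x Bx.
    by apply: (lt_le_trans (hBC _ (or_introl Bx))); rewrite /= ge_min lexx.
  by apply: (lt_le_trans (hBC _ (or_intror Bx))); rewrite /= ge_min lexx orbT.
have : {family @tvs_bounded R E, filter_from D N --> (f : E -> R^o)}.
  apply/fam_cvgP => B bB P /uniform_nbhs[V [/= entV sV]].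
  move: entV; rewrite -entourage_from_ballE => -[e e0 eV].
  exists (B, e) => //= h Bh; apply: sV => x Bx; apply: eV.
  by rewrite /= -ball_normE /=; exact: Bh.
move=> /(_ W) [|[B e] [/= bB e0] sW]; first by apply: open_nbhs_nbhs.
by exists B => //; exists e => // g Bg; apply: sA; exact: sW.
Qed.

(** The margin [d < e], uniform on [B], replaces a supremum and makes the ball open; in [dual_ball]
    the differences may come arbitrarily close to [e]. *)
Definition dual_open_ball f B (e : R) : set (strong_dual E) :=
  [set g | exists2 d, d < e & forall x, B x -> `|f x - g x| <= d].

Lemma dual_open_ball_open f B e : tvs_bounded B -> open (dual_open_ball f B e).
Proof.
move=> bB; rewrite openE => g [d de fg]; apply/strong_dual_nbhsP.
exists B => //; exists ((e - d) / 2) => [|h gh]; first by lra.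
exists (d + (e - d) / 2) => [|x Bx]; first by lra.
rewrite -(subrKA (g x)) (le_trans (ler_normD _ _))// lerD ?fg//.
exact/ltW/gh.
Qed.

Lemma dual_open_ball_convex f B e : convex_set (dual_open_ball f B e).
Proof.
move=> g h t; rewrite !inE => -[d de fg] [d' d'e fh].
exists (Num.max d d') => [|x Bx]; first by rewrite gt_max de.
have -> : f x - dual_fun (conv t g h) x =
    t%:num * (f x - g x) + (1 - t%:num) * (f x - h x).
  change (dual_fun (conv t g h) x) with (t%:num * g x + (1 - t%:num) * h x).
  by rewrite !mulrBr mulrBl mul1r mulrBl mul1r; lra.
by apply: ler_norm_conv; [exact: ge0|exact: le1|
  rewrite le_max fg|rewrite le_max fh ?orbT].
Qed.

Lemma strong_dual_add_continuous :
  continuous (fun z : strong_dual E * strong_dual E => z.1 + z.2).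
Proof.
move=> [f g] A /strong_dual_nbhsP[B bB [e e0 sA]].
have e20 : 0 < e / 2 by lra.
exists (dual_ball f B (e / 2), dual_ball g B (e / 2)) => /=.
  by split; apply/strong_dual_nbhsP; exists B => //; exists (e / 2).
move=> [f' g'] [/= ff' gg']; apply: sA => x Bx.
change (`|(f x + g x) - (f' x + g' x)| < e).
rewrite opprD addrACA (le_lt_trans (ler_normD _ _))// (splitr e) ltrD//.
  exact: ff'.
exact: gg'.
Qed.

Lemma strong_dual_scale_continuous :
  continuous (fun z : R^o * strong_dual E => z.1 *: z.2).
Proof.
move=> [a f] A /strong_dual_nbhsP[B bB [e e0 sA]].
have [M M0 fM] := dual_bounded f bB.
(* In [a f - b g = (a - b) f + b (f - g)], the second bound on [|a - b|] keeps the first term below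
   [e / 2]; the bound 1 gives [|b| <= |a| + 1], which controls the other term. *)
pose d : R := Num.min 1 (e / (2 * M)).
have d0 : 0 < d by rewrite lt_min ltr01 divr_gt0// mulr_gt0.
have a0 : 0 < `|a| + 1 by rewrite ltr_wpDl.
have c0 : 0 < e / (2 * (`|a| + 1)) by rewrite divr_gt0// mulr_gt0.
exists (ball a d, dual_ball f B (e / (2 * (`|a| + 1)))) => /=.
  split; first exact: nbhsx_ballx.
  by apply/strong_dual_nbhsP; exists B => //; exists (e / (2 * (`|a| + 1))).
move=> [b g] [/= ab fg]; apply: sA => x Bx.
change (`|a * f x - b * g x| < e).
have -> : a * f x - b * g x = (a - b) * f x + b * (f x - g x) by lra.
move: ab; rewrite -ball_normE /= lt_min => /andP[ab1 abM].
have b1 : `|b| <= `|a| + 1.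
  by rewrite -[b](subKr a) (le_trans (ler_normB _ _))// lerD2l ltW.
rewrite (le_lt_trans (ler_normD _ _))// (splitr e) !normrM ltr_leD//.
  rewrite (@lt_le_trans _ _ (e / (2 * M) * M))//.
    by rewrite ltr_pM// fM.
  by rewrite invfM mulrA mulfVK ?gt_eqF.
rewrite (@le_trans _ _ ((`|a| + 1) * (e / (2 * (`|a| + 1)))))//.
  by rewrite ler_pM// ltW// fg.
by rewrite mulrC invfM mulrA mulfVK ?gt_eqF.
Qed.

Lemma strong_dual_locally_convex : locally_convex_tvs (strong_dual E).
Proof.
split.
- exact: strong_dual_add_continuous.
- exact: strong_dual_scale_continuous.
exists [set U | exists f B e, tvs_bounded B /\ U = dual_open_ball f B e].
  by move=> U; rewrite inE => -[f [B [e [_ ->]]]]; exact: dual_open_ball_convex.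
split=> [_ [f [B [e [bB ->]]]]|f A /strong_dual_nbhsP[B bB [e e0 sA]]].
  exact: dual_open_ball_open.
exists (dual_open_ball f B e) => /=; first split.
- by exists f, B, e.
- by exists 0 => // x _; rewrite subrr normr0.
by move=> g [d de fg]; apply: sA => x /fg/le_lt_trans; apply.
Qed.

End strong_dual_topology.

(** * Metrizability of the strong dual *)

Lemma min_le_minD {R : realDomainType} (a b d k : R) :
  0 <= k -> 0 <= a -> 0 <= b -> d <= a + b ->
  Num.min d k <= Num.min a k + Num.min b k.
Proof.
move=> k0 a0 b0 dab.
(* If a term on the right is capped, it alone reaches [k]; otherwise the right side is [a + b]. *)
by case: (leP d k) => ?; case: (leP a k) => ?; case: (leP b k) => ?; lra.
Qed.

Definition is_distance {R : realType} {T : Type} (d : T -> T -> R) : Prop :=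
  [/\ forall x, d x x = 0, forall x y, d x y = 0 -> x = y,
      forall x y, d x y = d y x & forall y x z, d x z <= d x y + d y z].

(** The proof that [d] is a distance is an argument of the alias, so that the type determines its
    metric structure. *)
Definition metric_of {R : realType} {T : Type} (d : T -> T -> R)
  of is_distance d : Type := T.

Section metric_of.
Context {R : realType} {T : choiceType} (d : T -> T -> R) (dP : is_distance d).

HB.instance Definition _ := Choice.on (metric_of dP).

Let dxx (x : metric_of dP) : d x x = 0. Proof. by have [+ _ _ _] := dP; apply. Qed.
Let dpos (x y : metric_of dP) : d x y = 0 -> x = y.
Proof. by have [_ + _ _] := dP; apply. Qed.
Let dsym (x y : metric_of dP) : d x y = d y x.
Proof. by have [_ _ + _] := dP; apply. Qed.
Let dtri (y x z : metric_of dP) : d x z <= d x y + d y z.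
Proof. by have [_ _ _ +] := dP; apply. Qed.

HB.instance Definition _ :=
  isMetric.Build R (metric_of dP) dxx dpos dsym dtri.
End metric_of.

Lemma distance_metrizable {R : realType} {T : topologicalType} (d : T -> T -> R) :
  is_distance d ->
  (forall x A, nbhs x A <-> exists2 e, 0 < e & [set y | d x y < e] `<=` A) ->
  @metrizable R T.
Proof.
move=> dP dnbhs.
have nbhs_metric (x : metric_of dP) A :
    nbhs x A <-> exists2 e, 0 < e & [set y | d x y < e] `<=` A.
  by rewrite -nbhs_ballE; split=> -[e e0 sA]; exists e => // y; exact: sA.
exists (metric_of dP), id, id; split=> // x A.
  by move=> /nbhs_metric/dnbhs.
by move=> /dnbhs/nbhs_metric.
Qed.

Section strong_dual_metrizable.
Context {R : realType} {E : preTopologicalLmodType R} (c : nat -> set E).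
Implicit Types f g h : strong_dual E.

(** The cap [1/(k+1)] bounds all gaps by 1 and makes the contribution of [c k] small for large [k],
    whatever the forms do there. *)
Definition dual_gaps f g : set R :=
  [set r | exists k x, c k x /\ r = Num.min `|f x - g x| k.+1%:R^-1].

Definition dual_dist f g : R := sup (dual_gaps f g).

Let dual_gaps_bounded f g : has_ubound (dual_gaps f g).
Proof.
exists 1 => _ [k [x [_ ->]]]; rewrite ge_min; apply/orP; right.
by rewrite invf_le1// ler1n.
Qed.

Lemma dual_dist_ge f g k x : c k x -> Num.min `|f x - g x| k.+1%:R^-1 <= dual_dist f g.
Proof. by move=> ckx; apply: ub_le_sup => //; exists k, x. Qed.

Context (c_cover : forall x, exists k, c k x).

Lemma dual_dist_le f g e :
  (forall k x, c k x -> Num.min `|f x - g x| k.+1%:R^-1 <= e) ->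
  dual_dist f g <= e.
Proof.
move=> fg; apply: ge_sup => [|_ [k [x [/fg + ->]]]//].
(* Bounding the supremum from above requires a gap to exist; the point 0 provides one. *)
by have [k c0] := c_cover 0; exists (Num.min `|f 0 - g 0| k.+1%:R^-1), k, 0.
Qed.

Lemma dual_dist_is_distance : is_distance dual_dist.
Proof.
have k0 k : 0 <= k.+1%:R^-1 :> R by [].
split=> [f|f g fg0|f g|g f h].
- apply/eqP; rewrite eq_le dual_dist_le => [|k x _] /=.
    have [k c0] := c_cover 0.
    by apply: le_trans (dual_dist_ge f f c0); rewrite subrr normr0 le_min lexx k0.
  by rewrite subrr normr0 ge_min lexx.
- apply: val_inj; apply/funext => x /=; have [k ckx] := c_cover x.
  apply/eqP; rewrite -subr_eq0 -normr_le0.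
  have := dual_dist_ge f g ckx; rewrite fg0 ge_min => /orP[//|].
  by rewrite leNgt invr_gt0 ltr0Sn.
- by congr sup; apply/seteqP; split=> _ [k [x [ckx ->]]]; exists k, x; rewrite distrC.
apply: dual_dist_le => k x ckx.
apply: le_trans (lerD (dual_dist_ge f g ckx) (dual_dist_ge g h ckx)).
by apply: min_le_minD => //; exact: ler_distD.
Qed.

Context (c_bounded : forall k, tvs_bounded (c k))
  (c_nondecreasing : forall k, c k `<=` c k.+1)
  (c_cofinal : forall B, tvs_bounded B -> exists k, B `<=` c k).

Let c_le j k : (j <= k)%N -> c j `<=` c k.
Proof.
have trans B A D : A `<=` B -> B `<=` D -> A `<=` D := @subset_trans E B A D.
exact: (homo_leq (r := @subset E) (@subset_refl E) trans c_nondecreasing).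
Qed.

Lemma strong_dual_metrizable : @metrizable R (strong_dual E).
Proof.
apply: (distance_metrizable dual_dist_is_distance) => f A.
split=> [/strong_dual_nbhsP[B /c_cofinal[k Bk] [e e0 sA]]|[e e0 sA]].
  (* A distance below [1/(k+1)] rules out the cap on [c k], so the gap is the difference itself. *)
  exists (Num.min e k.+1%:R^-1) => [|g]; first by rewrite lt_min e0 invr_gt0 ltr0Sn.
  move=> /= fg; apply: sA => x /Bk ckx.
  have := le_lt_trans (dual_dist_ge f g ckx) fg.
  rewrite lt_min !gt_min ltxx orbF => /andP[/orP[//|ke] /lt_le_trans]; apply.
  exact: ltW.
(* With [1/(k+1) < e], the cap handles every [c j] with [j > k], and closeness on [c k] handles the
   smaller ones. The radius [e / 2] leaves room because a supremum only inherits a weak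
   inequality. *)
have [k _ /(_ k (leqnn k)) /= ke] := near_infty_natSinv_lt (PosNum e0).
apply/strong_dual_nbhsP; exists (c k) => //; exists (e / 2) => [|g fg]; first by lra.
apply: sA; rewrite /= (@le_lt_trans _ _ (Num.max (e / 2) k.+1%:R^-1))//.
  apply: dual_dist_le => j x cjx.
  have [jk|kj] := leqP j k.
    by rewrite ge_min le_max ltW ?fg//; apply: c_le jk x cjx.
  rewrite ge_min !le_max.
  by rewrite lef_pV2 ?posrE// ler_nat ltnW ?orbT.
by rewrite gt_max ke andbT; lra.
Qed.

End strong_dual_metrizable.

(** * Completeness, given continuity of uniform limits on bounded sets *)

Lemma strong_dual_complete {R : realType} {E : preTopologicalLmodType R} :
  (forall x : E, tvs_bounded [set x]) ->
  (forall l : E -> R^o, linear l ->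
    (forall B (e : R), tvs_bounded B -> 0 < e ->
      exists g : strong_dual E, forall x, B x -> `|l x - g x| <= e) ->
    continuous l) ->
  tvs_complete (strong_dual E).
Proof.
move=> b1 limc F FF cF.
have cauchyF B (e : R) : tvs_bounded B -> 0 < e -> exists2 A : set (strong_dual E),
    F A & forall g h, A g -> A h -> forall x, B x -> `|g x - h x| < e.
  move=> bB e0; have [|A FA sA] := cF (dual_ball 0 B e).
    by apply/strong_dual_nbhsP; exists B => //; exists e.
  exists A => // g h Ag Ah x Bx; rewrite -normrN -[- _]add0r.
  exact: (sA _ _ Ag Ah x Bx).
have cvx x : cvg ((fun f : strong_dual E => f x : R^o) @ F).
  apply/cauchy_cvgP/cauchyP => e e0.
  have [A FA sA] := cauchyF _ _ (b1 x) e0.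
  have [g Ag] := filter_ex FA.
  exists (g x); change (F [set h | ball (g x : R^o) e (h x)]).
  by apply: filterS FA => h Ah; rewrite /= -ball_normE /=; exact: sA.
pose l x : R^o := lim ((fun f : strong_dual E => f x : R^o) @ F).
have linl : linear l.
  move=> a x y; apply: cvg_lim => //.
  under eq_fun do rewrite dual_linear.
  by apply: cvgD; [apply: cvgZr; exact: cvx|exact: cvx].
have unif B (e : R) : tvs_bounded B -> 0 < e -> exists2 A : set (strong_dual E),
    F A & forall g, A g -> forall x, B x -> `|l x - g x| <= e.
  move=> bB e0; have [A FA sA] := cauchyF _ _ bB e0.
  exists A => // g Ag x Bx.
  (* With [g] fixed in [A], the other form runs along [F]. The set [A] does not depend on [x], so
     the limit is uniform on [B]. *)
  have lx : (fun f : strong_dual E => `|f x - g x|) @ F --> `|l x - g x|.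
    by apply: cvg_norm; apply: cvgB; [exact: cvx|exact: cvg_cst].
  apply: (cvgr_to_le lx).
  by apply: filterS FA => h Ah; exact: ltW (sA h g Ah Ag x Bx).
have cl : continuous l.
  apply: limc => // B e bB e0; have [A FA sA] := unif B e bB e0.
  by have [g Ag] := filter_ex FA; exists g; exact: sA.
have lP : l \in @continuous_linear_form R E by apply/asboolP.
exists (ContinuousDual lP) => A /strong_dual_nbhsP[B bB [e e0 sA]].
have e20 : 0 < e / 2 by lra.
have [A' FA' sA'] := unif _ _ bB e20.
apply: filterS FA' => g A'g; apply: sA => x Bx.
by rewrite (le_lt_trans (sA' _ A'g _ Bx))//; lra.
Qed.

(** * Continuity of linear forms for the localized topology *)

Section localization_continuity.
Context {R : realType} {X : preTopologicalLmodType R} (CC : set (set X)).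

(** The union of all open sets whose trace on [C] lies in [U] is open and cuts out the trace of [U],
    so relative openness can be checked pointwise. *)
Lemma trace_topologyP (C U : set X) :
  trace_topology C (U `&` C) <->
  forall x, U x -> C x -> exists W, [/\ open W, W x & W `&` C `<=` U].
Proof.
split=> [[W oW WU] x Ux Cx|UW].
  have WUC y : W y /\ C y <-> U y /\ C y.
    by change ((W `&` C) y <-> (U `&` C) y); rewrite WU.
  by exists W; split=> [||y /WUC[]] //; have [] := (WUC x).2 (conj Ux Cx).
exists (\bigcup_(W in [set W | open W /\ W `&` C `<=` U]) W).
  by apply: bigcup_open => W [].
apply/seteqP; split=> [x [[W [oW WU] Wx] Cx]|x [Ux Cx]].
  by split=> //; exact: WU.
by have [W [oW Wx WU]] := UW x Ux Cx; split=> //; exists W.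
Qed.

Lemma localization_open_trace (U : set (localization CC)) (C : set X) :
  open U -> CC C -> trace_topology C (U `&` C).
Proof.
move=> oU CCC; apply/trace_topologyP => x Ux Cx.
have [V [_ Vx VU tV]] := oU x Ux.
have [W [oW Wx WV]] := (trace_topologyP C V).1 (tV C CCC) x Vx Cx.
by exists W; split=> // y /WV/VU.
Qed.

Lemma localization_linear_continuous (l : localization CC -> R^o) : linear l ->
  (forall C, CC C -> forall U : set R, open U ->
    trace_topology C ((l @^-1` U : set X) `&` C)) ->
  continuous l.
Proof.
move=> linl tl; apply/continuousP => A; rewrite openE => oA.
move=> x /oA/nbhs_ballP[e e0 eA].
exists (l @^-1` ball (l x) e); split.
- move=> y z t; rewrite !inE /= => ly lz.
  have lt : l (conv t y z) = t%:num * l y + (1 - t%:num) * l z.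
    have l0 : l 0 = 0.
      by have := linl (-1) 0 0; rewrite scaler0 addr0 scaleN1r addNr.
    by rewrite linl -[_ *: z]addr0 linl l0 addr0.
  rewrite lt -!ball_normE /= in ly lz *.
  have -> : l x - (t%:num * l y + (1 - t%:num) * l z) =
      t%:num * (l x - l y) + (1 - t%:num) * (l x - l z) by lra.
  apply: (@le_lt_trans _ _ (Num.max `|l x - l y| `|l x - l z|)).
    by apply: ler_norm_conv; [exact: ge0|exact: le1|
      rewrite le_max lexx|rewrite le_max lexx orbT].
  by rewrite gt_max ly.
- exact: ballxx.
- by move=> y /eA.
- by move=> C CCC; apply: tl => //; exact: ball_open.
Qed.

Lemma localization_uniform_limit_continuous (l : localization CC -> R^o) :
  linear l ->
  (forall C (e : R), CC C -> 0 < e -> exists g : strong_dual (localization CC),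
    forall x, C x -> `|l x - g x| <= e) ->
  continuous l.
Proof.
move=> linl lg; apply: localization_linear_continuous => // C CCC U.
rewrite openE => oU; apply/trace_topologyP => x /oU/nbhs_ballP[e /= e0 eU] Cx.
(* Three errors of at most [e / 4] add up to less than [e]: [l] against [g] at [x] and at [y], and
   the variation of [g] from [x] to [y]. *)
have e40 : 0 < e / 4 by lra.
have [g lgC] := lg _ _ CCC e40.
have /asboolP[_ /continuousP cg] := dual_funP g.
have oW : open (g @^-1` ball (g x : R^o) (e / 4)) by apply: cg; exact: ball_open.
(* The preimage under [g] is open only for the localization; inside [C] it contains the trace of a
   neighbourhood [W] of [x] that is open in [X]. *)
have /trace_topologyP := localization_open_trace oW CCC.
move=> /(_ x (ballxx _ e40) Cx)[W [oW' Wx WV]].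
exists W; split=> // y [Wy Cy]; apply: eU; have := WV y (conj Wy Cy).
rewrite /= -!ball_normE /= => gxy.
have -> : l x - l y = (l x - g x) + ((g x - g y) - (l y - g y)) by lra.
have := ler_normD (l x - g x) ((g x - g y) - (l y - g y)).
have := ler_normB (g x - g y) (l y - g y).
have := lgC _ Cx; have := lgC _ Cy; lra.
Qed.

End localization_continuity.

Theorem theorem5p3 (R : realType) (X : tvsType R) (CC : set (set X))
  (hausdorffX : hausdorff_space X)
  (locCC : localizing_family CC)
  (countCC : nondecreasing_countable CC)
  (closedCC : forall C, CC C -> closed C)
  (boundedCC : forall B : set (localization CC),
     tvs_bounded B <-> exists2 C, CC C & B `<=` C) :
  frechet_space (strong_dual (localization CC)).
Proof.
have [[C0 CC0] zero transl] := locCC; have [c cE c_nondecr] := countCC.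
have CCc k : CC (c k) by rewrite cE; exists k.
have bounded (C : set X) : CC C -> tvs_bounded (C : set (localization CC)).
  by move=> CCC; apply/boundedCC; exists C.
have bounded1 (x : localization CC) : tvs_bounded [set x].
  (* The scalar [t = 0] shrinks [C0] to the origin, so some member of [CC] contains [x]. *)
  have [D CCD xD] := transl C0 x 0 CC0; apply/boundedCC; exists D => // _ ->.
  by apply: xD; exists 0; [case: (zero _ CC0)|rewrite scaler0 addr0].
have cofinal (B : set (localization CC)) : tvs_bounded B -> exists k, B `<=` c k.
  by move=> /boundedCC[C]; rewrite {1}cE => -[k _ <-]; exists k.
split.
- exact: strong_dual_locally_convex.
- apply: (@strong_dual_metrizable _ (localization CC) c) => //.
    by move=> x; have [k xk] := cofinal _ (bounded1 x); exists k; exact: xk.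
  by move=> k; exact: bounded.
- apply: strong_dual_complete => // l linl lg.
  apply: localization_uniform_limit_continuous => // C e CCC e0.
  by apply: lg => //; exact: bounded.
Qed.
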